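(* For positive integers $m$ and $n$, let $H_n^{(m)}=\sum_{k=1}^n \frac{1}{k^m}$ denote the harmonic number of order $m$. Then for every positive integer $m$, the sequence $\left(\sqrt[n+1]{H_{n+1}^{(m)}}/\sqrt[n]{H_n^{(m)}}\right)_{n\geq 3}$ is strictly increasing. *)

(* Defs.v *)
From Stdlib Require Import Reals Lra Lia.
From Coquelicot Require Import Coquelicot.
Open Scope R_scope.

Definition harmonic (m n : nat) : R := sum_n_m (fun k => / INR k ^ m) 1 n.

(* Meaningful only for [0 < n] and [0 < x]; see [nth_root_pow]. *)
Definition nth_root (n : nat) (x : R) : R := Rpower x (/ INR n).

Lemma nth_root_pos (n : nat) (x : R) : 0 < nth_root n x.
Proof. apply exp_pos. Qed.

Lemma nth_root_pow (n : nat) (x : R) :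
  (0 < n)%nat -> 0 < x -> nth_root n x ^ n = x.
Proof.
  intros Hn Hx.
  rewrite <- Rpower_pow by apply nth_root_pos.
  unfold nth_root; rewrite Rpower_mult, Rinv_l.
  - now apply Rpower_1.
  - apply not_0_INR; lia.
Qed.

Definition root_ratio (m n : nat) : R :=
  nth_root (n + 1) (harmonic m (n + 1)) / nth_root n (harmonic m n).

(* Main.v *)
(** Put [L_n = ln H_n], [d_n = L_(n+1) - L_n].  The claim is that [L_n / n] has
    positive second difference, which after multiplication by [n (n+1) (n+2)] reads
    [n (n+3) d_n < 2 L_n + n (n+1) d_(n+1)].  The bounds
    [d_n <= (n+1)^-m / H_n] and [d_(n+1) >= (n+2)^-m / H_(n+2)] leave an
    inequality between [ln H_n] and rational functions.  For [m >= 2] it follows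
    from [ln H >= 1 - 1/H], for [m = 1] and [n >= 4] from
    [ln H >= 2 (H-1) / (H+1)].  The case [m = 1], [n = 3] is too tight for these
    bounds and amounts to [6^2 25^18 125^12 < 11^2 22^18 137^12]. *)

Require Import Defs.
From Stdlib Require Import Reals Lra Lia.
From Coquelicot Require Import Coquelicot.
Open Scope R_scope.

(** * Elementary bounds for the logarithm *)

Lemma ln_le_sub1 (y : R) : 0 < y -> ln y <= y - 1.
Proof.
  intros Hy.
  pose proof (exp_ineq1_le (ln y)) as H.
  rewrite exp_ln in H by assumption; lra.
Qed.

Lemma ln_ge_1_sub_inv (y : R) : 0 < y -> 1 - / y <= ln y.
Proof.
  intros Hy.
  pose proof (ln_le_sub1 (/ y) (Rinv_0_lt_compat _ Hy)) as H.
  rewrite ln_Rinv in H by assumption; lra.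
Qed.

(** The difference of the two sides vanishes at 1, and its derivative [1 / x - 4 / (x + 1) ^ 2]
    equals [(x - 1) ^ 2 / (x * (x + 1) ^ 2)], which is nonnegative; the mean value theorem
    concludes. *)
Lemma ln_ge_pade (y : R) : 1 <= y -> 2 * (y - 1) / (y + 1) <= ln y.
Proof.
  intros Hy.
  destruct (MVT_gen (fun x => ln x - 2 * (x - 1) / (x + 1)) 1 y
              (fun x => (x - 1) ^ 2 / (x * (x + 1) ^ 2))) as [c [Hc E]].
  - intros x Hx; rewrite Rmin_left in Hx by lra.
    auto_derive; [lra | field; lra].
  - intros x Hx; rewrite Rmin_left in Hx by lra.
    apply derivable_continuous_pt; exists ((x - 1) ^ 2 / (x * (x + 1) ^ 2)).
    apply is_derive_Reals; auto_derive; [lra | field; lra].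
  - rewrite Rmin_left, Rmax_right in Hc by lra.
    rewrite ln_1 in E.
    assert (0 <= (c - 1) ^ 2 / (c * (c + 1) ^ 2)).
    { apply Rmult_le_pos; [apply pow2_ge_0 |].
      apply Rlt_le, Rinv_0_lt_compat, Rmult_lt_0_compat; [lra | apply pow_lt; lra]. }
    assert (0 <= (c - 1) ^ 2 / (c * (c + 1) ^ 2) * (y - 1))
      by (apply Rmult_le_pos; lra).
    lra.
Qed.

(** * Harmonic numbers *)

Lemma harmonic_1 (m : nat) : harmonic m 1 = 1.
Proof.
  unfold harmonic; rewrite sum_n_n; simpl INR; rewrite pow1; apply Rinv_1.
Qed.

Lemma harmonic_S (m n : nat) : harmonic m (S n) = harmonic m n + / INR (S n) ^ m.
Proof. unfold harmonic; rewrite sum_n_Sm by lia; reflexivity. Qed.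

Lemma inv_INR_S_pow_pos (m n : nat) : 0 < / INR (S n) ^ m.
Proof. apply Rinv_0_lt_compat, pow_lt, lt_0_INR; lia. Qed.

Lemma harmonic_le (m k n : nat) : (k <= n)%nat -> harmonic m k <= harmonic m n.
Proof.
  induction 1 as [| n _ IH]; [lra |].
  rewrite harmonic_S; pose proof (inv_INR_S_pow_pos m n); lra.
Qed.

Lemma harmonic_ge_1 (m n : nat) : (1 <= n)%nat -> 1 <= harmonic m n.
Proof. intros Hn; rewrite <- (harmonic_1 m); now apply harmonic_le. Qed.

(** With [harmonic_le] this bounds [harmonic m n] from below for [n >= 3], which is where that
    restriction enters for orders at least 2. *)
Lemma harmonic_3 (m : nat) : harmonic m 3 = 1 + / 2 ^ m + / 3 ^ m.
Proof.
  rewrite (harmonic_S m 2), (harmonic_S m 1), harmonic_1.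
  replace (INR 2) with 2 by (simpl; lra).
  replace (INR 3) with 3 by (simpl; lra).
  reflexivity.
Qed.

(** * Reduction to a rational inequality *)

Lemma root_ratio_exp (m n : nat) :
  root_ratio m n =
  exp (ln (harmonic m (S n)) / INR (S n) - ln (harmonic m n) / INR n).
Proof.
  unfold root_ratio, nth_root, Rpower, Rdiv, Rminus.
  rewrite Nat.add_1_r, <- exp_Ropp, <- exp_plus.
  f_equal; ring.
Qed.

Lemma root_ratio_lt_S (m n : nat) (x := INR n) : (1 <= n)%nat ->
  x * (x + 3) * ln (harmonic m (S n) / harmonic m n)
    < 2 * ln (harmonic m n)
      + x * (x + 1) * ln (harmonic m (S (S n)) / harmonic m (S n)) ->
  root_ratio m n < root_ratio m (S n).
Proof.
  intros Hn H.
  assert (Hx : 1 <= x) by (apply (le_INR 1); lia).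
  pose proof (harmonic_ge_1 m n Hn).
  pose proof (harmonic_ge_1 m (S n) ltac:(lia)).
  pose proof (harmonic_ge_1 m (S (S n)) ltac:(lia)).
  rewrite !ln_div in H by lra.
  rewrite !root_ratio_exp; apply exp_increasing.
  rewrite !S_INR; fold x.
  set (L0 := ln (harmonic m n)) in *; set (L1 := ln (harmonic m (S n))) in *.
  set (L2 := ln (harmonic m (S (S n)))) in *.
  apply Rlt_0_minus.
  (* The coefficients match because [2 + x (x + 3) = (x + 1) (x + 2)] for [L0] and
     [x (x + 1) + x (x + 3) = 2 x (x + 2)] for [L1]. *)
  replace (L2 / (x + 1 + 1) - L1 / (x + 1) - (L1 / (x + 1) - L0 / x))
    with ((2 * L0 + x * (x + 1) * (L2 - L1) - x * (x + 3) * (L1 - L0))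
          / (x * (x + 1) * (x + 2))) by (field; lra).
  apply Rdiv_lt_0_compat; [lra |].
  repeat apply Rmult_lt_0_compat; lra.
Qed.

Lemma root_ratio_lt_S_rational (m n : nat) (x := INR n) : (1 <= n)%nat ->
  x * (x + 3) * (/ (x + 1) ^ m / harmonic m n)
    < 2 * ln (harmonic m n)
      + x * (x + 1) * (/ (x + 2) ^ m / harmonic m (S (S n))) ->
  root_ratio m n < root_ratio m (S n).
Proof.
  intros Hn H.
  apply root_ratio_lt_S; [assumption |]; fold x.
  assert (Hx : 1 <= x) by (apply (le_INR 1); lia).
  pose proof (harmonic_ge_1 m n Hn) as G0.
  pose proof (harmonic_ge_1 m (S n) ltac:(lia)) as G1.
  pose proof (harmonic_ge_1 m (S (S n)) ltac:(lia)) as G2.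
  assert (U : ln (harmonic m (S n) / harmonic m n) <= / (x + 1) ^ m / harmonic m n).
  { eapply Rle_trans; [apply ln_le_sub1, Rdiv_lt_0_compat; lra |].
    rewrite harmonic_S, S_INR; fold x.
    apply Req_le; field; split; try apply pow_nonzero; lra. }
  assert (V : / (x + 2) ^ m / harmonic m (S (S n))
              <= ln (harmonic m (S (S n)) / harmonic m (S n))).
  { eapply Rle_trans; [| apply ln_ge_1_sub_inv, Rdiv_lt_0_compat; lra].
    rewrite Rinv_div.
    replace (harmonic m (S n))
      with (harmonic m (S (S n)) - / (x + 2) ^ m).
    - apply Req_le; field; split; try apply pow_nonzero; lra.
    - rewrite (harmonic_S m (S n)), !S_INR; fold x.
      replace (x + 1 + 1) with (x + 2) by ring; ring. }
  apply (Rmult_le_compat_l (x * (x + 3))) in U;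
    [| apply Rmult_le_pos; lra].
  apply (Rmult_le_compat_l (x * (x + 1))) in V;
    [| apply Rmult_le_pos; lra].
  lra.
Qed.

(** * Orders at least 2 *)

Lemma root_ratio_lt_S_of_order_ge3 (m n : nat) : (3 <= m)%nat -> (3 <= n)%nat ->
  root_ratio m n < root_ratio m (S n).
Proof.
  intros Hm Hn.
  apply root_ratio_lt_S_rational; [lia |].
  set (x := INR n).
  assert (Hx : 3 <= x) by (replace 3 with (INR 3) by (simpl; lra); now apply le_INR).
  pose proof (harmonic_ge_1 m n ltac:(lia)) as G0.
  pose proof (harmonic_ge_1 m (S (S n)) ltac:(lia)) as G2.
  pose proof (harmonic_le m 3 n Hn) as G3; rewrite harmonic_3 in G3.
  pose proof (ln_ge_1_sub_inv (harmonic m n) ltac:(lra)) as L.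
  set (H := harmonic m n) in *.
  (* For these orders the contribution of [d_(n+1)] can be discarded: its sign is enough. *)
  assert (0 < x * (x + 1) * (/ (x + 2) ^ m / harmonic m (S (S n)))).
  { apply Rmult_lt_0_compat; [apply Rmult_lt_0_compat; lra |].
    apply Rdiv_lt_0_compat; [| lra].
    apply Rinv_0_lt_compat, pow_lt; lra. }
  assert (K : x * (x + 3) * / (x + 1) ^ m < 2 * (H - 1)).
  { replace m with (3 + (m - 3))%nat in * by lia.
    set (u := (m - 3)%nat) in *.
    rewrite !pow_add, !Rinv_mult in G3.
    rewrite pow_add, Rinv_mult, <- Rmult_assoc.
    (* The bound is attained at [x = 3]. The remaining powers with exponent [u] are all compared
       with [/ 4 ^ u], which reduces the claim to [9/32 < 2 (1/8 + 1/27)]. *)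
    assert (A : x * (x + 3) * / (x + 1) ^ 3 <= 9 / 32).
    { apply Rmult_le_reg_r with ((x + 1) ^ 3); [apply pow_lt; lra |].
      rewrite Rmult_assoc, Rinv_l by (apply pow_nonzero; lra).
      nra. }
    assert (P4 : 0 < / 4 ^ u) by (apply Rinv_0_lt_compat, pow_lt; lra).
    assert (P2 : / 4 ^ u <= / 2 ^ u)
      by (apply Rinv_le_contravar; [apply pow_lt; lra | apply pow_incr; lra]).
    assert (P3 : / 4 ^ u <= / 3 ^ u)
      by (apply Rinv_le_contravar; [apply pow_lt; lra | apply pow_incr; lra]).
    assert (Px : / (x + 1) ^ u <= / 4 ^ u)
      by (apply Rinv_le_contravar; [apply pow_lt; lra | apply pow_incr; lra]).
    assert (0 < / (x + 1) ^ u) by (apply Rinv_0_lt_compat, pow_lt; lra).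
    assert (x * (x + 3) * / (x + 1) ^ 3 * / (x + 1) ^ u <= 9 / 32 * / 4 ^ u).
    { apply Rle_trans with (9 / 32 * / (x + 1) ^ u);
        [apply Rmult_le_compat_r; lra | lra]. }
    lra. }
  assert (x * (x + 3) * (/ (x + 1) ^ m / H) < 2 * (1 - / H)).
  { replace (2 * (1 - / H)) with (2 * (H - 1) * / H) by (field; lra).
    replace (x * (x + 3) * (/ (x + 1) ^ m / H))
      with (x * (x + 3) * / (x + 1) ^ m * / H) by (unfold Rdiv; ring).
    apply Rmult_lt_compat_r; [apply Rinv_0_lt_compat; lra | exact K]. }
  lra.
Qed.

Lemma root_ratio_lt_S_of_order_2 (n : nat) : (3 <= n)%nat ->
  root_ratio 2 n < root_ratio 2 (S n).
Proof.
  intros Hn.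
  apply root_ratio_lt_S_rational; [lia |].
  assert (Hx : 3 <= INR n)
    by (replace 3 with (INR 3) by (simpl; lra); now apply le_INR).
  pose proof (harmonic_le 2 3 n Hn) as G3; rewrite harmonic_3 in G3.
  rewrite !harmonic_S, !S_INR.
  set (x := INR n) in *.
  pose proof (ln_ge_1_sub_inv (harmonic 2 n) ltac:(lra)) as L.
  set (H := harmonic 2 n) in *.
  assert (E1 : 0 < / (x + 1) ^ 2 <= / 16).
  { split; [apply Rinv_0_lt_compat; nra | apply Rinv_le_contravar; nra]. }
  assert (E2 : 0 < / (x + 1 + 1) ^ 2 <= / 25).
  { split; [apply Rinv_0_lt_compat; nra | apply Rinv_le_contravar; nra]. }
  set (H2 := H + / (x + 1) ^ 2 + / (x + 1 + 1) ^ 2) in *.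
  (* Here [H >= 49/36] and [H2 - H <= 1/16 + 1/25]. The constants [9/8] and [12/25] below are the
     values at [x = 3]. Then [K] follows from [9/8 < 13/18 + 12/25 * 92/100], so for order 2 the
     last term cannot be dropped. *)
  assert (Q : 92 / 100 <= H / H2).
  { apply (Rle_div_r (92 / 100) H H2); unfold H2; lra. }
  assert (A : x * (x + 3) * / (x + 1) ^ 2 <= 9 / 8).
  { apply (Rle_div_l (x * (x + 3)) (9 / 8) ((x + 1) ^ 2)); nra. }
  assert (B : 12 / 25 <= x * (x + 1) * / (x + 2) ^ 2).
  { apply (Rle_div_r (12 / 25) (x * (x + 1)) ((x + 2) ^ 2)); nra. }
  assert (C : 12 / 25 * (92 / 100) <= x * (x + 1) * / (x + 2) ^ 2 * (H / H2))
    by (apply Rmult_le_compat; lra).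
  assert (K : x * (x + 3) * / (x + 1) ^ 2
              < 2 * (H - 1) + x * (x + 1) * / (x + 2) ^ 2 * (H / H2)) by lra.
  apply (Rmult_lt_compat_r (/ H)) in K; [| apply Rinv_0_lt_compat; lra].
  assert (HH : H <> 0) by lra.
  assert (HH2 : 0 < H2) by (unfold H2; lra).
  replace ((2 * (H - 1) + x * (x + 1) * / (x + 2) ^ 2 * (H / H2)) * / H)
    with (2 * (1 - / H) + x * (x + 1) * (/ (x + 2) ^ 2 / H2)) in K
    by (field; lra).
  unfold Rdiv in *; lra.
Qed.

(** * Order 1 *)

Lemma harmonic_order1_3 : harmonic 1 3 = 11 / 6.
Proof. rewrite harmonic_3; field. Qed.

Lemma harmonic_order1_4 : harmonic 1 4 = 25 / 12.
Proof. rewrite harmonic_S, harmonic_order1_3; simpl; field. Qed.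

Lemma harmonic_order1_5 : harmonic 1 5 = 137 / 60.
Proof. rewrite harmonic_S, harmonic_order1_4; simpl; field. Qed.

Lemma harmonic_order1_6 : harmonic 1 6 = 49 / 20.
Proof. rewrite harmonic_S, harmonic_order1_5; simpl; field. Qed.

Lemma root_ratio_lt_S_order_1_at_3 : root_ratio 1 3 < root_ratio 1 4.
Proof.
  apply root_ratio_lt_S; [lia |].
  rewrite harmonic_order1_3, harmonic_order1_4, harmonic_order1_5.
  replace (INR 3) with 3 by (simpl; lra).
  replace (25 / 12 / (11 / 6)) with (25 / 22) by field.
  replace (137 / 60 / (25 / 12)) with (137 / 125) by field.
  (* The coefficients 18, 12 and 2 move inside the logarithms as exponents, leaving a comparison of
     explicit rational numbers. *)
  replace (3 * (3 + 3)) with (INR 18) by (simpl; lra).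
  replace (3 * (3 + 1)) with (INR 12) by (simpl; lra).
  change 2 with (INR 2).
  rewrite <- !ln_pow, <- ln_mult by (try apply pow_lt; lra).
  apply ln_increasing; [apply pow_lt |]; lra.
Qed.

Lemma root_ratio_lt_S_of_order_1 (n : nat) : (3 <= n)%nat ->
  root_ratio 1 n < root_ratio 1 (S n).
Proof.
  intros Hn.
  destruct (Nat.eq_dec n 3) as [-> | N3]; [exact root_ratio_lt_S_order_1_at_3 |].
  apply root_ratio_lt_S_rational; [lia |].
  (* The uniform estimate below needs [H >= 49/20], the value at [n = 6], so 4 and 5 are checked
     numerically. *)
  destruct (Nat.eq_dec n 4) as [-> | N4].
  { rewrite harmonic_order1_4, harmonic_order1_6.
    pose proof (ln_ge_pade (25 / 12) ltac:(lra)).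
    simpl; lra. }
  destruct (Nat.eq_dec n 5) as [-> | N5].
  { rewrite (harmonic_S 1 6), harmonic_order1_5, harmonic_order1_6.
    pose proof (ln_ge_pade (137 / 60) ltac:(lra)).
    simpl; lra. }
  assert (Hx : 6 <= INR n)
    by (replace 6 with (INR 6) by (simpl; lra); apply le_INR; lia).
  pose proof (harmonic_le 1 6 n ltac:(lia)) as G; rewrite harmonic_order1_6 in G.
  rewrite !harmonic_S, !S_INR, !pow_1.
  set (x := INR n) in *; set (H := harmonic 1 n) in *.
  (* At [49/20] the bound of [ln_ge_pade] is [58/69], slightly above [84/100]. *)
  assert (L : 84 / 100 <= ln H).
  { apply Rle_trans with (ln (49 / 20)).
    - pose proof (ln_ge_pade (49 / 20) ltac:(lra)); lra.
    - apply ln_le; lra. }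
  set (e := / (x + 1) + / (x + 1 + 1)).
  assert (He : 0 < e).
  { unfold e; apply Rplus_lt_0_compat; apply Rinv_0_lt_compat; lra. }
  replace (H + / (x + 1) + / (x + 1 + 1)) with (H + e) by (unfold e; ring).
  assert (C : x * (x + 1) / (x + 2) * e <= 2).
  { replace (x * (x + 1) / (x + 2) * e) with (x * (2 * x + 3) / (x + 2) ^ 2)
      by (unfold e; field; lra).
    apply (Rle_div_l (x * (2 * x + 3)) 2 ((x + 2) ^ 2)); nra. }
  (* The two fractions nearly cancel: what remains is at most [3 / H + 2 / H^2]. *)
  assert (D : x * (x + 3) * (/ (x + 1) / H) - x * (x + 1) * (/ (x + 2) / (H + e))
              = (3 - 2 * e) * / H + x * (x + 1) / (x + 2) * e * / (H * (H + e))).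
  { assert (E : e = (2 * x + 3) / ((x + 1) * (x + 2)))
      by (unfold e; field; lra).
    replace (3 - 2 * e)
      with (x * (x + 3) / (x + 1) - x * (x + 1) / (x + 2))
      by (rewrite E; field; lra).
    field; lra. }
  assert (I1 : 0 < / H <= 20 / 49).
  { replace (20 / 49) with (/ (49 / 20)) by field.
    split; [apply Rinv_0_lt_compat | apply Rinv_le_contravar]; lra. }
  assert (I2 : 0 < / (H * (H + e)) <= / (49 / 20 * (49 / 20))).
  { split; [apply Rinv_0_lt_compat | apply Rinv_le_contravar]; nra. }
  assert ((3 - 2 * e) * / H <= 3 * (20 / 49)) by nra.
  assert (x * (x + 1) / (x + 2) * e * / (H * (H + e))
          <= 2 * / (49 / 20 * (49 / 20))).
  { apply Rle_trans with (2 * / (H * (H + e)));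
      [apply Rmult_le_compat_r; lra | lra]. }
  (* The margin is [3 * 20/49 + 2 * (20/49)^2 < 1.56 < 2 * 84/100]. *)
  lra.
Qed.

Theorem theorem1p3 (m : nat) (hm : (1 <= m)%nat) :
  forall i j : nat, (3 <= i)%nat -> (i < j)%nat -> root_ratio m i < root_ratio m j.
Proof.
  assert (step : forall n, (3 <= n)%nat -> root_ratio m n < root_ratio m (S n)).
  { intros n Hn.
    destruct m as [| [| [| k]]]; [lia | | |].
    - now apply root_ratio_lt_S_of_order_1.
    - now apply root_ratio_lt_S_of_order_2.
    - apply root_ratio_lt_S_of_order_ge3; [lia | assumption]. }
  intros i j Hi Hij.
  induction Hij as [| j Hij IH]; [now apply step |].
  apply Rlt_trans with (root_ratio m j); [exact IH |].
  apply step; lia.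
Qed.
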